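(* Let $(X, \|\cdot\|)$ be a real strictly convex, reflexive and separable Banach space and let $F \subset X$ be a bounded set with non-empty interior. Then the following are equivalent: (a) $F$ is an existence set; (b) $F$ is a contractive set; (c) $F$ is the intersection of a countable number of contractive half-spaces; (d) $F$ is an optimal set.
   Context: For a non-empty set $F \subset X$ and $x \in X$, let $R_F(x) = \{ d \in F : \|d-c\| \le \|x-c\| \text{ for all } c \in F\}$; $F$ is an existence set if $R_F(x) \neq \emptyset$ for every $x \in X$. A non-empty set $D \subset X$ is contractive if there exists $P : X \to D$ with $P|_D = \mathrm{id}_D$ and $\|Px - Py\| \le \|x-y\|$ for all $x,y \in X$. A half-space is a set $\{x : f(x) \le d\}$ with $f \in X^*\setminus\{0\}$, $d \in \mathbb{R}$; a contractive half-space is a half-space which is contractive. $\mathrm{Min}(F)$ is the set of $z \in X$ such that for every $x \in X$: if $\|x - c\| \le \|z - c\|$ for all $c \in F$, then $x = z$. Always $F \subset \mathrm{Min}(F)$; $F$ is called optimal if $\mathrm{Min}(F) = F$. *)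

(* Defs.v *)
From HB Require Import structures.
From mathcomp Require Import all_boot all_order all_algebra.
From mathcomp Require Import all_classical all_reals all_analysis.
Set Implicit Arguments. Unset Strict Implicit. Unset Printing Implicit Defensive.
Import Order.TTheory GRing.Theory Num.Theory.
Import numFieldNormedType.Exports.
Local Open Scope classical_set_scope.
Local Open Scope ring_scope.

Section Defs.
Context {R : realType} {X : normedModType R}.

Definition is_linear_functional (f : X -> R) :=
  forall (a : R) (x y : X), f (a *: x + y) = a * f x + f y.

Definition in_dual (f : X -> R) := is_linear_functional f /\ continuous f.

Definition strictly_convex :=
  forall x y : X, `|x| = 1 -> `|y| = 1 -> x <> y -> `|(2^-1) *: (x + y)| < 1.

Definition separable := exists D : set X, countable D /\ dense D.

(* reflexivity: every bounded linear functional Phi on X^* is evaluation at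
   some x in X.  Boundedness of Phi w.r.t. the operator norm on X^* is written
   as: |Phi f| <= C * M whenever |f x| <= M * ||x|| for all x
   (i.e. |Phi f| <= C * ||f||_{X^*}). *)
Definition reflexive_space :=
  forall Phi : (X -> R) -> R,
    (forall (a : R) (f g : X -> R), in_dual f -> in_dual g ->
       Phi (fun x => a * f x + g x) = a * Phi f + Phi g) ->
    (exists C : R, forall (f : X -> R) (M : R), in_dual f ->
       (forall x, `|f x| <= M * `|x|) -> `|Phi f| <= C * M) ->
    exists x0 : X, forall f, in_dual f -> Phi f = f x0.


Definition RF (F : set X) (x : X) : set X :=
  [set d | F d /\ forall c, F c -> `|d - c| <= `|x - c|].

Definition existence_set (F : set X) := F !=set0 /\ forall x, RF F x !=set0.

Definition contractive (D : set X) :=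
  D !=set0 /\
  exists P : X -> X, (forall x, D (P x)) /\ (forall d, D d -> P d = d) /\
    (forall x y, `|P x - P y| <= `|x - y|).

Definition half_space (H : set X) :=
  exists (f : X -> R) (d : R), in_dual f /\ f <> (fun _ => 0) /\
    H = [set x | f x <= d].

Definition contractive_half_space (H : set X) := half_space H /\ contractive H.

Definition countable_inter_contractive_half_spaces (F : set X) :=
  exists I : set (set X), countable I /\
    (forall H, I H -> contractive_half_space H) /\ F = \bigcap_(H in I) H.

Definition Min (F : set X) : set X :=
  [set z | forall x, (forall c, F c -> `|x - c| <= `|z - c|) -> x = z].

Definition optimal (F : set X) := Min F = F.

End Defs.

(* Main.v *)
(** For a minimal point [z], every point of [RF F z] equals [z], so (a) gives (d).
    Minimal maps: order the maps [T : X -> X] by the distances [`|T x - c|], [c] in [F].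
    By reflexivity bounded families have weak limits along ultrafilters and the norm is
    weakly lower semicontinuous, so Zorn's lemma gives minimal elements in suitable
    classes; by strict convexity a minimal [T] equals every map of the class below it.
    The values of a minimal map are minimal points of [F], so (d) gives (a).  Among the
    nonexpansive maps fixing [F], a minimal [T] satisfies [P \o T = T] for every
    nonexpansive [P] fixing [F]; applied to the retractions onto contractive half-spaces
    this gives (b) from (c).
    From (a) to (c): [F] is closed and convex, and by Mazur's theorem (Baire category and
    separability) any point off [F] is separated from [F] by the supporting half-space
    [H] of [F] at a smooth boundary point [e].  At such a point the dilations of [F] from
    [e] fill the interior of [H]; rescaling the points of [RF F (e + v / n)] and passing to
    a weak limit yields [u] with [f u = 1] such that [y - f y *: u] is a norm one
    projection onto the kernel of [f], and [H] is contractive.  The Lindelof property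
    leaves countably many half-spaces. *)
Require Import Defs.
From HB Require Import structures.
From mathcomp Require Import all_boot all_order all_algebra.
From mathcomp Require Import all_classical all_reals all_analysis.
From mathcomp Require Import lra.
Import Order.TTheory GRing.Theory Num.Theory.
Import numFieldNormedType.Exports.
Local Open Scope classical_set_scope.
Local Open Scope ring_scope.

(** * Zorn's lemma for minimal elements of a preorder *)

Lemma zorn_min (T : Type) (P : set T) (le : T -> T -> Prop) :
  (forall t, le t t) -> (forall r s t, le r s -> le s t -> le r t) ->
  P !=set0 ->
  (forall A : set T, A `<=` P -> A !=set0 -> total_on A le ->
    exists2 t, P t & forall s, A s -> le t s) ->
  exists2 t, P t & forall s, P s -> le s t -> le t s.
Proof.
move=> lexx le_trans [t0 Pt0] chain.
pose R := fun s t : {t | P t} => `[< le (sval t) (sval s) >].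
have [||A Atot|t tmax] := @ZL_preorder {t | P t} (exist _ t0 Pt0) R.
- by move=> t; apply/asboolP.
- by move=> r s t /asboolP rs /asboolP st; apply/asboolP; apply: le_trans st rs.
- have [[s As]|A0] := pselect (A !=set0); last first.
    by exists (exist _ t0 Pt0) => s As; case: A0; exists s.
  have [_ [r _ <-]||r1 r2 [s1 As1 <-] [s2 As2 <-]|t Pt tle] :=
      chain [set sval s | s in A].
  + exact: (svalP r).
  + by exists (sval s), s.
  + by have [/asboolP|/asboolP] := Atot _ _ As1 As2; [right|left].
  by exists (exist _ t Pt) => r Ar; apply/asboolP; apply: tle; exists r.
exists (sval t); first exact: (svalP t).
by move=> s Ps st; have /asboolP := tmax (exist _ s Ps) (introT (asboolP _) st).
Qed.

(** * Sublinear functionals and the Hahn-Banach theorem *)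

Section HahnBanach.
Context {R : realType} {V : normedModType R}.
Implicit Types (p q : V -> R) (x y : V).

(** Homogeneity is only an inequality for [0 < t], which is easy to check for infima; applied to
    [t^-1] it gives the equality. *)
Definition sublinear p :=
  (forall x y, p (x + y) <= p x + p y) /\
  (forall t x, 0 < t -> p (t *: x) <= t * p x).

Lemma sublinear0 p : sublinear p -> p 0 = 0.
Proof.
move=> [_ pZ]; have := pZ 2 0 (ltr0Sn _ 1); have := pZ 2^-1 0.
rewrite !scaler0 invr_gt0 ltr0Sn => /(_ isT); lra.
Qed.

Lemma sublinearZ p t x : sublinear p -> 0 <= t -> p (t *: x) = t * p x.
Proof.
move=> sp; rewrite le_eqVlt => /predU1P[<-|t0].
  by rewrite scale0r mul0r sublinear0.
have [_ pZ] := sp; apply/eqP; rewrite eq_le pZ //=.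
rewrite -ler_pdivlMl//; apply: le_trans (pZ t^-1 (t *: x) _); last first.
  by rewrite invr_gt0.
by rewrite scalerA mulVf ?scale1r// gt_eqF.
Qed.

Lemma sublinearN p x : sublinear p -> - p (- x) <= p x.
Proof.
by move=> sp; have := sp.1 x (- x); rewrite subrr sublinear0//; lra.
Qed.

Lemma le_infD (A B : set R) m : A !=set0 -> B !=set0 ->
  (forall a b, A a -> B b -> m <= a + b) -> m <= inf A + inf B.
Proof.
move=> A0 B0 mAB; rewrite -lerBlDr; apply: lb_le_inf => // a Aa.
rewrite lerBlDr -lerBlDl; apply: lb_le_inf => // b Bb.
by rewrite lerBlDl mAB.
Qed.

(** The infimal convolution of [p] with the function of value [- (t * p y)] at [- (t *: y)] on the
    ray of [- y]. *)
Definition tilt p y x := inf [set p (x + t *: y) - t * p y | t in [set t | 0 <= t]].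

Lemma tilt_le p y x t : sublinear p -> 0 <= t ->
  tilt p y x <= p (x + t *: y) - t * p y.
Proof.
move=> sp t0; apply: ge_inf; last by exists t.
(* Indeed [s * p y = p (s *: y) <= p (x + s *: y) + p (- x)]. *)
exists (- p (- x)) => _ [s s0 <-].
have := sp.1 (x + s *: y) (- x).
by rewrite addrAC subrr add0r sublinearZ//; lra.
Qed.

Lemma tilt_set0 p y x :
  [set p (x + t *: y) - t * p y | t in [set t | 0 <= t]] !=set0.
Proof. by exists (p (x + 0 *: y) - 0 * p y); exists 0 => /=. Qed.

Lemma sublinear_tilt p y : sublinear p -> sublinear (tilt p y).
Proof.
move=> sp; split=> [x z|s x s0].
  apply: le_infD; [exact: tilt_set0|exact: tilt_set0|].
  move=> _ _ [a a0 <-] [b b0 <-].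
  have := tilt_le p y (x + z) (a + b) sp (addr_ge0 a0 b0).
  have := sp.1 (x + a *: y) (z + b *: y).
  by rewrite addrACA -scalerDl; lra.
rewrite -ler_pdivrMl//; apply: lb_le_inf; first exact: tilt_set0.
move=> _ [t t0 <-]; rewrite ler_pdivrMl// mulrBr.
have st0 : 0 <= s * t by rewrite mulr_ge0// ltW.
apply: le_trans (tilt_le _ _ _ (s * t) sp st0) _.
by rewrite -mulrA lerD2r -scalerA -scalerDr sp.2.
Qed.

(* A minimal sublinear functional equals all its tilts, hence is additive; minimizing
   below [tilt p x0], whose value at [- x0] is at most [- p x0], forces [f x0 = p x0]. *)
Theorem hahn_banach p x0 : sublinear p ->
  exists f : V -> R, [/\ is_linear_functional f, forall x, f x <= p x & f x0 = p x0].
Proof.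
move=> sp.
have tiltp q y x : sublinear q -> tilt q y x <= q x.
  by move=> /tilt_le - /(_ y x 0 (lexx _)); rewrite scale0r mul0r addr0 subr0.
pose P := [set q | sublinear q /\ forall x, q x <= tilt p x0 x].
have [||||q [sq qp] qmin] := @zorn_min _ P (fun q r => forall x, q x <= r x).
- by [].
- by move=> q r s qr rs x; apply: le_trans (rs x).
- by exists (tilt p x0); split=> //; exact: sublinear_tilt.
- move=> A AP [q0 Aq0] Atot.
  pose S x := [set q x | q in A].
  have S0 x : S x !=set0 by exists (q0 x), q0.
  have inflb q x : A q -> inf (S x) <= q x.
    move=> Aq; apply: ge_inf; last by exists q.
    (* Members of the chain lie below [tilt p x0], and [r x >= - r (- x)]; so the infimum is
       finite. *)
    exists (- tilt p x0 (- x)) => _ [r Ar <-].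
    by have [sr rp] := AP _ Ar; have := sublinearN _ x sr; have := rp (- x); lra.
  exists (fun x => inf (S x)); last by move=> s As x; exact: inflb.
  split; [split|].
  + move=> x y; apply: le_infD => // _ _ [r Ar <-] [s As <-].
    have [rs|sr] := Atot _ _ Ar As.
      have := inflb r (x + y) Ar; have [[+ _] _] := AP _ Ar => /(_ x y).
      by have := rs y; lra.
    have := inflb s (x + y) As; have [[+ _] _] := AP _ As => /(_ x y).
    by have := sr x; lra.
  + move=> t x t0; rewrite -ler_pdivrMl//; apply: lb_le_inf => // _ [r Ar <-].
    rewrite ler_pdivrMl//; apply: le_trans (inflb _ _ Ar) _.
    by have [[_ +] _] := AP _ Ar; apply.
  + by move=> x; apply: le_trans (inflb _ _ Aq0) _; have [_ +] := AP _ Aq0; apply.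
have qadd x y : q (x + y) = q x + q y.
  apply/eqP; rewrite eq_le sq.1 /=.
  have Pt : P (tilt q y).
    split; first exact: sublinear_tilt.
    by move=> z; apply: le_trans (qp z); exact: tiltp.
  have := qmin _ Pt (fun z => tiltp _ _ _ sq) x.
  have := tilt_le q y x 1 sq ler01; rewrite scale1r mul1r; lra.
have qN x : q (- x) = - q x.
  by have := qadd x (- x); rewrite subrr sublinear0//; lra.
exists q; split.
- move=> a x y; rewrite qadd; congr (_ + _).
  have [a0|a0] := leP 0 a; first by rewrite sublinearZ.
  by rewrite -[a]opprK scaleNr qN sublinearZ ?mulNr// oppr_ge0 ltW.
- by move=> x; apply: le_trans (qp x) (tiltp _ _ _ sp).
- apply/eqP; rewrite eq_le (le_trans (qp x0) (tiltp _ _ _ sp)) /=.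
  have := qp (- x0); have := tilt_le p x0 (- x0) 1 sp ler01.
  by rewrite scale1r addNr mul1r sublinear0// qN; lra.
Qed.

End HahnBanach.

(** * Dual functionals and weak limits along ultrafilters *)

Section WeakLimits.
Context {R : realType} {X : normedModType R}.
Implicit Types (f : X -> R) (x y : X).

Lemma linear_functionalB f x y : is_linear_functional f -> f (x - y) = f x - f y.
Proof.
by move=> /(_ (-1) y x); rewrite scaleN1r addrC => ->; rewrite mulN1r addrC.
Qed.

Lemma linear_functional0 f : is_linear_functional f -> f 0 = 0.
Proof. by move=> lf; rewrite -(subrr (0 : X)) linear_functionalB// subrr. Qed.

Lemma linear_functionalD f x y : is_linear_functional f -> f (x + y) = f x + f y.
Proof. by move=> /(_ 1 x y); rewrite scale1r mul1r. Qed.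

Lemma linear_functionalZ f a x : is_linear_functional f -> f (a *: x) = a * f x.
Proof.
by move=> lf; have := lf a x 0; rewrite addr0 linear_functional0// addr0.
Qed.

Lemma dist_le_continuous (k : R) f :
  (forall x y, `|f x - f y| <= k * `|x - y|) -> continuous f.
Proof.
move=> fk x; apply/cvgrPdist_le => e e0; near=> y.
apply: le_trans (fk x y) _.
have k1 : 0 < `|k| + 1 by rewrite ltr_wpDl.
apply: (@le_trans _ _ ((`|k| + 1) * `|x - y|)).
  by rewrite ler_wpM2r// (le_trans (ler_norm k))// lerDl.
rewrite -ler_pdivlMl// mulrC; near: y.
apply/nbhs_normP; exists (e / (`|k| + 1)) => [|z /ltW//].
exact: divr_gt0.
Unshelve. all: end_near. Qed.

Lemma in_dual_le (k : R) f : is_linear_functional f ->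
  (forall x, f x <= k * `|x|) -> in_dual f.
Proof.
move=> lf fk; split=> //; apply: (@dist_le_continuous k) => x y.
rewrite ler_norml -{2}linear_functionalB// fk andbT lerNl opprB distrC.
by rewrite -linear_functionalB.
Qed.

Lemma in_dual_bounded f : in_dual f -> exists k : R, forall x, `|f x| <= k * `|x|.
Proof.
move=> [lf cf]; have := cf 0.
rewrite /continuous_at linear_functional0// => /cvgr0Pnorm_le /(_ 1 ltr01).
move=> /nbhs_norm0P[d /= d0 fd]; exists (2 / d) => x.
have [->|x0] := eqVneq x 0; first by rewrite linear_functional0// !normr0 mulr0.
have nx : 0 < `|x| by rewrite normr_gt0.
(* The multiple of [x] of norm [d / 2] lies in the ball where [f] is bounded by 1. *)
have s0 : 0 < d / 2 / `|x| by rewrite !divr_gt0.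
have := fd ((d / 2 / `|x|) *: x).
rewrite /= normrZ linear_functionalZ// (normrM _ (f x)) !(gtr0_norm s0).
rewrite divfK ?gt_eqF// => fx.
rewrite -(@ler_pM2l _ (d / 2 / `|x|))// mulrACA; apply: le_trans (fx _) _.
  by rewrite ltr_pdivrMr// ltr_pMr// ltr1n.
by rewrite mulVf ?gt_eqF// mulr1 mulrA divfK ?divff ?gt_eqF.
Qed.

Definition weak_cvg {I : Type} (U : set_system I) (x : I -> X) (l : X) :=
  forall f, in_dual f -> f (x i) @[i --> U] --> f l.

Lemma weak_cvg_cst {I : Type} (U : set_system I) {FU : Filter U} (c : X) :
  weak_cvg U (fun=> c) c.
Proof. by move=> f _; exact: cvg_cst. Qed.

Lemma ultra_fmap {I T : Type} (U : set_system I) {UU : UltraFilter U} (g : I -> T) :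
  UltraFilter (g i @[i --> U]).
Proof.
split=> [|G PG UG]; first exact: fmap_proper_filter.
apply/seteqP; split=> [B GB|]; last exact: UG.
have [//|gB] := in_ultra_setVsetC (g @^-1` B) UU.
have GCB : G (~` B) by exact: UG.
by have [x []] := @filter_ex _ _ PG _ (filterI GB GCB).
Qed.

Lemma ultra_bounded_cvg {I : Type} (U : set_system I) {UU : UltraFilter U}
  (g : I -> R) (M : R) :
  (\forall i \near U, `|g i| <= M) -> cvg (g i @[i --> U]).
Proof.
move=> gM; have := @segment_compact R (- M) M; rewrite compact_ultra.
move=> /(_ (g i @[i --> U]) (ultra_fmap U g)) [|l [_ gl]]; last first.
  by apply/cvg_ex; exists l.
by apply: filterS gM => i; rewrite /= in_itv /= ler_norml.
Qed.

Lemma norming_functional (x : X) : exists f,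
  [/\ in_dual f, forall y, f y <= `|y| & f x = `|x|].
Proof.
have [|f [lf fle fx]] := @hahn_banach R X (fun y => `|y|) x.
  split=> [y z|t y t0]; first exact: ler_normD.
  by rewrite normrZ gtr0_norm.
by exists f; split=> //; apply: (@in_dual_le 1) => // y; rewrite mul1r.
Qed.

(** The limits of [f (x i)] along [U] form a bounded linear functional of [f], which reflexivity
    represents by a point. *)
Lemma reflexive_weak_cvg {I : Type} (U : set_system I) {UU : UltraFilter U}
  (x : I -> X) (C : R) : @reflexive_space R X ->
  (\forall i \near U, `|x i| <= C) -> exists l, weak_cvg U x l.
Proof.
move=> refl xC.
(* A nonzero point forces every bound [M] of a functional to be nonnegative; in the zero space the
   family is constant. *)
have [[x0 x0n0]|X0] := pselect (exists x0 : X, x0 != 0); last first.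
  exists 0 => f df; suff -> : x = fun=> 0 by exact: cvg_cst.
  by apply/funext => i; apply/eqP/negP => /negP xi; case: X0; exists (x i).
have Mge0 (f : X -> R) M : (forall x, `|f x| <= M * `|x|) -> 0 <= M.
  move=> fM; rewrite -(@pmulr_lge0 _ `|x0|) ?normr_gt0//.
  exact: le_trans (normr_ge0 _) (fM x0).
have fC (f : X -> R) M : (forall x, `|f x| <= M * `|x|) ->
    \forall i \near U, `|f (x i)| <= C * M.
  move=> fM; apply: filterS xC => i xiC; apply: le_trans (fM _) _.
  by rewrite mulrC ler_wpM2r// (Mge0 f).
have cvgf f : in_dual f -> cvg (f (x i) @[i --> U]).
  by move=> /in_dual_bounded[k /fC]; exact: ultra_bounded_cvg.
have [||l lP] := refl (fun f => lim (f (x i) @[i --> U])).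
- move=> a f g df dg; apply/cvg_lim => //.
  by apply: cvgD; [apply: cvgMr; exact: cvgf|exact: cvgf].
- exists C => f M df fM; have /cvg_norm fl := cvgf _ df.
  by apply: (closed_cvg _ (@closed_le _ (C * M)) _ _ fl); exact: fC.
- by exists l => f df; rewrite -lP//; exact: cvgf.
Qed.

(** Weak lower semicontinuity of the norm: test the limits against a functional norming
    [lx - ly]. *)
Lemma weak_cvg_dist_le {I : Type} {U : set_system I} {PU : ProperFilter U}
  {x y : I -> X} {lx ly : X} {K : R} : weak_cvg U x lx -> weak_cvg U y ly ->
  (\forall i \near U, `|x i - y i| <= K) -> `|lx - ly| <= K.
Proof.
move=> xlx yly xyK; have [f [df fle fl]] := norming_functional (lx - ly).
rewrite -fl linear_functionalB; last exact: df.1.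
apply: (closed_cvg _ (@closed_le _ K) _ _ (cvgB (xlx _ df) (yly _ df))).
apply: filterS xyK => i xyi /=; apply: le_trans xyi.
by have := fle (x i - y i); rewrite linear_functionalB//; exact: df.1.
Qed.

End WeakLimits.

(** * Minimal maps under strict convexity *)

Section MinimalMaps.
Context {R : realType} {X : normedModType R}.
Implicit Types (F : set X) (Q : set (X -> X)).

Lemma midpointB (x y z : X) :
  2^-1 *: (x + y) - z = 2^-1 *: ((x - z) + (y - z)).
Proof.
have zz : z + z = 2 *: z by rewrite scaler_nat mulr2n.
by rewrite addrACA -opprD zz scalerBr scalerA mulVf ?pnatr_eq0// scale1r.
Qed.

Lemma norm_midpoint_le (x y : X) (r : R) : `|x| <= r -> `|y| <= r ->
  `|2^-1 *: (x + y)| <= r.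
Proof.
move=> xr yr; rewrite normrZ gtr0_norm ?invr_gt0//.
rewrite ler_pdivrMl// (le_trans (ler_normD _ _))//; lra.
Qed.

(** If the midpoint had norm [r], both vectors would have norm [r > 0], and scaling by [r^-1] would
    contradict strict convexity on the unit sphere. *)
Lemma strictly_convex_midpoint (x y : X) (r : R) : @strictly_convex R X ->
  `|x| <= r -> `|y| <= r -> x <> y -> `|2^-1 *: (x + y)| < r.
Proof.
move=> sc xr yr xy; rewrite lt_neqAle norm_midpoint_le// andbT.
apply/negP => /eqP mr.
have le2 : 2 * r <= `|x| + `|y|.
  rewrite -mr normrZ gtr0_norm ?invr_gt0// mulrA divff ?pnatr_eq0// mul1r.
  exact: ler_normD.
have [xE yE] : `|x| = r /\ `|y| = r by split; lra.
have r0 : 0 < r.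
  rewrite lt_neqAle -{2}xE normr_ge0 andbT; apply/negP => /eqP r0.
  by apply: xy; rewrite (normr0_eq0 (etrans xE (esym r0))) (normr0_eq0 (etrans yE (esym r0))).
have rV : 0 < r^-1 by rewrite invr_gt0.
have unit (z : X) : `|z| = r -> `|r^-1 *: z| = 1.
  by move=> zr; rewrite normrZ gtr0_norm// zr mulVf// gt_eqF.
have := sc _ _ (unit x xE) (unit y yE); rewrite -scalerDr scalerA mulrC -scalerA.
rewrite normrZ mr gtr0_norm// mulVf ?gt_eqF// ltxx => /(_ _)/wrap[] //.
by move=> /scalerI - /(_ (lt0r_neq0 rV)).
Qed.

Definition closer F (S T : X -> X) :=
  forall x c, F c -> `|S x - c| <= `|T x - c|.

(* In Zorn's lemma, a chain is bounded below by a pointwise weak limit along an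
   ultrafilter finer than its tails. *)
Lemma exists_closest_map F Q : @strictly_convex R X -> @reflexive_space R X ->
  F !=set0 -> Q !=set0 ->
  (forall S T, Q S -> Q T -> Q (fun x => 2^-1 *: (S x + T x))) ->
  (forall (U : set_system (X -> X)) T, UltraFilter U -> U Q ->
    (forall x, weak_cvg U (fun S => S x) (T x)) -> Q T) ->
  exists2 T, Q T & forall S, Q S -> closer F S T -> S = T.
Proof.
move=> sc refl [c0 Fc0] Q0 Qmid Qlim.
have [||A AQ [s0 As0] Atot|T QT Tmin] := @zorn_min _ Q (closer F) _ _ Q0.
- by move=> T x c _.
- by move=> S T V ST TV x c Fc; apply: le_trans (ST x c Fc) (TV x c Fc).
- pose G : set_system (X -> X) :=
    [set B | exists2 s, A s & forall t, A t -> closer F t s -> B t].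
  have closer_refl s : closer F s s by move=> x c.
  have closer_trans r s t : closer F r s -> closer F s t -> closer F r t.
    by move=> rs st x c Fc; apply: le_trans (rs x c Fc) (st x c Fc).
  have PG : ProperFilter G.
    apply: Build_ProperFilter_ex => [B [s As sB]|].
      by exists s; exact: sB.
    split=> [|B C [s As sB] [t At tC]|B C BC [s As sB]].
    + by exists s0.
    + have [st|ts] := Atot _ _ As At.
        exists s => // u Au us; split; first exact: sB.
        by apply: tC => //; exact: closer_trans us st.
      exists t => // u Au ut; split; last exact: tC.
      by apply: sB => //; exact: closer_trans ut ts.
    + by exists s => // t At ts; apply: BC; exact: sB.
  have [U [UU GU]] := ultraFilterLemma PG.
  have UP s : A s -> \forall t \near U, A t /\ closer F t s.
    by move=> As; apply: GU; exists s.
  have /choice[T UT] : forall x, exists l, weak_cvg U (fun S => S x) l.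
    move=> x; apply: (@reflexive_weak_cvg _ _ _ _ _ _ (`|s0 x - c0| + `|c0|)) => //.
    apply: filterS (UP _ As0) => t [_ /(_ x c0 Fc0) ts].
    by rewrite -[t x](subrK c0) (le_trans (ler_normD _ _))// lerD2r.
  exists T.
    by apply: Qlim UT; apply: filterS (UP _ As0) => t [/AQ].
  move=> s As x c Fc.
  apply: (weak_cvg_dist_le (UT x) (weak_cvg_cst _ c)).
  by apply: filterS (UP _ As) => t [_]; apply.
(* If [S x] and [T x] differ, the midpoint map is in [Q] and strictly closer than [T] to [c0] at
   [x], against minimality. *)
exists T => // S QS ST; apply/funext => x; apply: contrapT => STx.
have mT : closer F (fun x => 2^-1 *: (S x + T x)) T.
  by move=> y c Fc; rewrite midpointB norm_midpoint_le// ST.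
have := Tmin _ (Qmid _ _ QS QT) mT x c0 Fc0; apply/negP; rewrite -ltNge.
rewrite midpointB strictly_convex_midpoint// ?ST// => /(congr1 (+%R^~ c0)).
by rewrite !subrK.
Qed.

Lemma closer_id_fix F T : closer F T id -> forall c, F c -> T c = c.
Proof.
move=> Tid c Fc; apply/eqP; rewrite -subr_eq0 -normr_le0.
by have := Tid c c Fc; rewrite subrr normr0.
Qed.

Lemma closer_id_midpoint F S T : closer F S id -> closer F T id ->
  closer F (fun x => 2^-1 *: (S x + T x)) id.
Proof.
by move=> Sid Tid x c Fc; rewrite midpointB norm_midpoint_le ?Sid ?Tid.
Qed.

Lemma closer_id_lim F (U : set_system (X -> X)) T : UltraFilter U ->
  U [set S | closer F S id] -> (forall x, weak_cvg U (fun S => S x) (T x)) ->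
  closer F T id.
Proof.
move=> UU UF UT x c Fc; apply: (weak_cvg_dist_le (UT x) (weak_cvg_cst _ c)).
by apply: filterS UF => S; apply.
Qed.

Lemma optimal_existence_set F : @strictly_convex R X -> @reflexive_space R X ->
  F !=set0 -> optimal F -> existence_set F.
Proof.
move=> sc refl F0 Fopt.
have [||U T UU UQ UT|T QT Tmin] :=
    @exists_closest_map F [set T | closer F T id] sc refl F0.
- by exists id => x c.
- by move=> S T; exact: closer_id_midpoint.
- exact: closer_id_lim UQ UT.
split=> // x; exists (T x); split; last by move=> c Fc; exact: QT.
rewrite -Fopt => y yT.
(* Changing [T] at [x] alone gives a map closer than [T], hence equal to [T]. *)
pose S z := if z == x then y else T z.
have ST : closer F S T by move=> z c Fc; rewrite /S; case: eqP => // ->; exact: yT.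
have QS : closer F S id by move=> z c Fc; apply: le_trans (ST z c Fc) (QT z c Fc).
by rewrite -(Tmin S QS ST) /S eqxx.
Qed.

(* For the closest nonexpansive map T fixing F, and any nonexpansive P fixing F,
   the map P \o T is closer than T, hence equal to T: so T takes its values in the
   fixed points of P. *)
Lemma bigcap_contractive F (I : set (set X)) : @strictly_convex R X ->
  @reflexive_space R X -> F !=set0 -> (forall H, I H -> contractive H) ->
  F = \bigcap_(H in I) H -> contractive F.
Proof.
move=> sc refl F0 cI FI; split=> //.
pose nonexp (T : X -> X) := forall x y, `|T x - T y| <= `|x - y|.
have [|S T [SF Sn] [TF Tn]|U T UU UQ UT|T [TF Tn] Tmin] :=
    @exists_closest_map F [set T | closer F T id /\ nonexp T] sc refl F0.
- by exists id; split=> x c.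
- split=> [|x y]; first exact: closer_id_midpoint.
  by rewrite -scalerBr opprD addrACA norm_midpoint_le.
- split; first by apply: closer_id_lim UT; apply: filterS UQ => S [].
  move=> x y; apply: (weak_cvg_dist_le (UT x) (UT y)).
  by apply: filterS UQ => S [_]; apply.
exists T; split=> [x|]; last by split=> //; exact: closer_id_fix.
rewrite FI => H IH; have [_ [P [PH [Pid Pn]]]] := cI H IH.
have PF c : F c -> P c = c by rewrite {1}FI => Fc; apply: Pid; exact: Fc.
have PT : closer F (P \o T) T by move=> y c Fc /=; rewrite -{1}(PF c Fc).
suff <- : P \o T = T by exact: PH.
apply: Tmin => //; split=> [y c Fc|y z]; first exact: le_trans (PT y c Fc) (TF y c Fc).
exact: le_trans (Pn _ _) (Tn _ _).
Qed.

End MinimalMaps.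

(** * Closedness and convexity of existence sets *)

Section ExistenceSets.
Context {R : realType} {X : normedModType R}.
Implicit Types (F : set X) (x y : X).

(** A point [d] of [RF F x] satisfies [|d - x| <= 2 * |x - c|] for every [c] in [F]. *)
Lemma existence_set_closed F x : existence_set F ->
  (forall e : R, 0 < e -> exists2 c, F c & `|x - c| < e) -> F x.
Proof.
move=> [_ exF] xF; have [d [Fd dx]] := exF x.
have [<-//|dNx] := eqVneq d x.
have dx0 : 0 < `|d - x| / 2 by rewrite divr_gt0// normr_gt0 subr_eq0.
have [c Fc xc] := xF _ dx0.
have := ler_distD c d x; have := dx c Fc; rewrite (distrC c x); lra.
Qed.

(** For [z] on the segment and [d] in [RF F z] other than [z], the midpoint of [d] and [z] is
    strictly closer than [z] to both ends, against the triangle inequality. *)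
Lemma existence_set_convex F x y (s t : R) : @strictly_convex R X -> existence_set F ->
  F x -> F y -> 0 <= s -> 0 <= t -> s + t = 1 -> F (s *: x + t *: y).
Proof.
move=> sc [_ exF] Fx Fy s0 t0 st1; set z := _ + _.
have [d [Fd dz]] := exF z; suff <- : d = z by [].
apply: contrapT => dNz.
have zx : `|z - x| = t * `|x - y|.
  rewrite -(ger0_norm t0) -normrZ distrC; congr (`|_|).
  rewrite /z opprD addrA scalerBr; congr (_ - _).
  by rewrite -{1}[x]scale1r -scalerBl -st1 addrAC subrr add0r.
have zy : `|z - y| = s * `|x - y|.
  rewrite -(ger0_norm s0) -normrZ; congr (`|_|).
  rewrite /z -addrA scalerBr; congr (_ + _).
  by rewrite -{2}[y]scale1r -scalerBl -st1 opprD addrCA subrr addr0 scaleNr.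
have mid c : F c -> `|2^-1 *: (d + z) - c| < `|z - c|.
  move=> Fc; rewrite midpointB strictly_convex_midpoint// ?dz//.
  by move=> /(congr1 (+%R^~ c)); rewrite !subrK.
have := mid x Fx; have := mid y Fy; rewrite zx zy.
have := ler_distD (2^-1 *: (d + z)) x y; rewrite (distrC x (_ *: _)).
have : `|x - y| = s * `|x - y| + t * `|x - y| by rewrite -mulrDl st1 mul1r.
lra.
Qed.

End ExistenceSets.

(** * The Minkowski gauge of a closed convex set with interior *)

Section Gauge.
Context {R : realType} {X : normedModType R}.
Variables (F : set X) (a : X) (r : R).
Hypotheses (r_gt0 : 0 < r) (ballF : forall x, `|x - a| < r -> F x).
Hypothesis convexF : forall x y (s t : R),
  F x -> F y -> 0 <= s -> 0 <= t -> s + t = 1 -> F (s *: x + t *: y).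
Implicit Types x y : X.

Definition scales y : set R := [set t | 0 < t /\ F (a + t^-1 *: y)].
Definition gauge_at y := inf (scales y).

Lemma scales_gt y t : 0 < t -> `|y| / r < t -> scales y t.
Proof.
move=> t0 yt; split=> //; apply: ballF; rewrite addrAC subrr add0r normrZ.
by rewrite gtr0_norm ?invr_gt0// ltr_pdivrMl// -ltr_pdivrMr.
Qed.

Lemma scales_neq0 y : scales y !=set0.
Proof.
have y0 : 0 <= `|y| / r by rewrite divr_ge0// ltW.
by exists (`|y| / r + 1); apply: scales_gt; rewrite ?ltrDl// ltr_wpDl.
Qed.

Lemma gauge_at_le y t : scales y t -> gauge_at y <= t.
Proof. by move=> yt; apply: ge_inf => //; exists 0 => s [/ltW]. Qed.

Lemma gauge_at_le_norm y : gauge_at y <= r^-1 * `|y|.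
Proof.
apply/ler_addgt0Pr => e e0; apply: gauge_at_le.
have y0 : 0 <= `|y| / r by rewrite divr_ge0// ltW.
by rewrite mulrC; apply: scales_gt; rewrite ?ltrDl// ltr_wpDl.
Qed.

Lemma sublinear_gauge_at : sublinear gauge_at.
Proof.
split=> [x y|s x s0].
  apply: le_infD; [exact: scales_neq0|exact: scales_neq0|].
  move=> s t [s0 Fs] [t0 Ft]; apply: gauge_at_le.
  have st0 : 0 < s + t by rewrite addr_gt0.
  split=> //; have -> : a + (s + t)^-1 *: (x + y) =
      (s / (s + t)) *: (a + s^-1 *: x) + (t / (s + t)) *: (a + t^-1 *: y).
    rewrite !scalerDr addrACA -scalerDl -mulrDl divff ?gt_eqF// scale1r.
    by rewrite !scalerA !(mulrAC _ (s + t)^-1) !divff ?gt_eqF// !mul1r.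
  apply: convexF => //; [exact: divr_ge0 (ltW _) (ltW _)|exact: divr_ge0 (ltW _) (ltW _)|].
  by rewrite -mulrDl divff// gt_eqF.
rewrite -ler_pdivrMl//; apply: lb_le_inf; first exact: scales_neq0.
move=> t [t0 Ft]; rewrite ler_pdivrMl//; apply: gauge_at_le.
split; first exact: mulr_gt0.
by rewrite scalerA invfM mulrAC mulVf ?gt_eqF// mul1r.
Qed.

Lemma gauge_at_le1 z : F z -> gauge_at (z - a) <= 1.
Proof.
by move=> Fz; apply: gauge_at_le; split=> //; rewrite invr1 scale1r addrC subrK.
Qed.

Lemma gauge_at_lt1 y : gauge_at y < 1 -> F (a + y).
Proof.
move=> y1; have [t [t0 Ft] t1] := inf_lt (scales_neq0 y) y1.
have -> : a + y = t *: (a + t^-1 *: y) + (1 - t) *: a.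
  rewrite scalerDr scalerA divff ?gt_eqF// scale1r scalerBl scale1r.
  by rewrite addrAC addrCA subrr addr0.
apply: convexF => //; [|exact: ltW|by rewrite subr_ge0 ltW|by rewrite addrC subrK].
by apply: ballF; rewrite subrr normr0.
Qed.

Hypothesis closedF : forall x,
  (forall e : R, 0 < e -> exists2 c, F c & `|x - c| < e) -> F x.

Lemma gauge_at_le1P y : gauge_at y <= 1 -> F (a + y).
Proof.
move=> y1; apply: closedF => e e0.
(* This [t] gives [t < 1] and [t * |y| < e]: shrinking [y] by [1 - t] makes its gauge less than 1
   and moves it by less than [e]. *)
pose t := e / (`|y| + 1 + e).
have yp : 0 < `|y| + 1 by rewrite ltr_wpDl.
have t0 : 0 < t by rewrite divr_gt0// addr_gt0.
have t1 : t < 1 by rewrite ltr_pdivrMr ?mul1r ?ltrDr// addr_gt0.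
exists (a + (1 - t) *: y).
  apply: gauge_at_lt1; rewrite (sublinearZ _ _ _ sublinear_gauge_at) ?subr_ge0 ?ltW//.
  have t10 : 0 < 1 - t by rewrite subr_gt0.
  by apply: (@le_lt_trans _ _ ((1 - t) * 1)); [rewrite ler_pM2l|lra].
rewrite opprD addrACA subrr add0r scalerBl scale1r opprB addrCA subrr addr0.
rewrite normrZ gtr0_norm// /t mulrAC ltr_pdivrMr; last exact: addr_gt0.
by rewrite ltr_pM2l// -addrA ltrDl addr_gt0.
Qed.

End Gauge.

(** * Baire category and Mazur's theorem *)

Lemma dense_near (R : realType) (X : normedModType R) (D : set X) (x : X) (e : R) :
  dense D -> 0 < e -> exists2 v, D v & `|x - v| < e.
Proof.
move=> dD e0; have [] := dD (ball x e); [by exists x; exact: ballxx|exact: ball_open|].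
by move=> v []; rewrite -ball_normE /= => xv Dv; exists v.
Qed.

Section Mazur.
Context {R : realType} {X : completeNormedModType R}.
Implicit Types (p : X -> R) (v x y z : X).

Lemma sublinear_dist_le p (k : R) x y : sublinear p -> (forall z, p z <= k * `|z|) ->
  `|p x - p y| <= k * `|x - y|.
Proof.
move=> sp pk.
have pB u w : p u - p w <= k * `|u - w|.
  by apply: le_trans (pk _); rewrite lerBlDr -{1}(subrK w u) sp.1.
by rewrite ler_norml pB andbT lerNl opprB distrC pB.
Qed.

(** The slope of [p] along [v] jumps by less than 1 across [x]; with this fixed threshold in place
    of differentiability the set is open. *)
Definition smooth_along p v : set X :=
  [set x | exists2 t : R, 0 < t & p (x + t *: v) + p (x - t *: v) - 2 * p x < t].

Lemma open_smooth_along p (k : R) v : sublinear p ->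
  (forall z, p z <= k * `|z|) -> open (smooth_along p v).
Proof.
move=> sp pk; pose g (t : R) x := p (x + t *: v) + p (x - t *: v) - 2 * p x.
have -> : smooth_along p v = \bigcup_(t in [set t | 0 < t]) (g t @^-1` [set s | s < t]).
  by apply/seteqP; split=> x [t t0 xt]; exists t.
apply: bigcup_open => t _; apply: open_comp; last exact: open_lt.
move=> x _; apply: (@dist_le_continuous _ _ (4 * k)) => {}x y.
have := sublinear_dist_le _ _ x y sp pk.
have := sublinear_dist_le _ _ (x + t *: v) (y + t *: v) sp pk.
have := sublinear_dist_le _ _ (x - t *: v) (y - t *: v) sp pk.
rewrite (_ : x - t *: v - (y - t *: v) = x - y); last by rewrite opprB addrA subrK.
rewrite (_ : x + t *: v - (y + t *: v) = x - y); last first.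
  by rewrite opprD addrACA subrr addr0.
rewrite !ler_norml /g; lra.
Qed.

(* Otherwise the increments of [t |-> p (x + t *: v)] over consecutive steps of length
   [d / N] would grow by [d / N] at each step, hence by [d] after [N] steps, while they
   are [O(d / N)]. *)
Lemma dense_smooth_along p (k : R) v : sublinear p ->
  (forall z, p z <= k * `|z|) -> dense (smooth_along p v).
Proof.
move=> sp pk O [x Ox] oO.
have /nbhs_normP[e /= e0 xeO] : nbhs x O by exact: open_nbhs_nbhs.
apply: contrapT => OG0.
have step z t : `|z - x| < e -> 0 < t -> t <= p (z + t *: v) + p (z - t *: v) - 2 * p z.
  move=> zx t0; rewrite leNgt; apply/negP => zt; apply: OG0; exists z; split.
    by apply: xeO; rewrite /= distrC.
  by exists t.
pose d := e / (`|v| + 1); have v1 : 0 < `|v| + 1 by rewrite ltr_wpDl.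
have d0 : 0 < d by rewrite divr_gt0.
have dv : d * `|v| < e.
  by rewrite mulrAC ltr_pdivrMr// ltr_pM2l// ltrDl.
(* With this [N] the total growth [N * t] exceeds the two bounds [k * t * |v|] on the first and last
   increments together. *)
have [N N0 kN] : exists2 N : nat, (0 < N)%N & 2 * k * `|v| < N%:R.
  exists (Num.bound `|2 * k * `|v| |).+1 => //.
  apply: le_lt_trans (ler_norm _) _.
  by apply: lt_le_trans (archi_boundP (normr_ge0 _)) _; rewrite ler_nat.
have NR : 0 < N%:R :> R by rewrite ltr0n.
pose t := d / N%:R; have t0 : 0 < t by rewrite divr_gt0.
pose a j := p (x + (j.+1%:R * t) *: v) - p (x + (j%:R * t) *: v).
have a_le j : `|a j| <= k * (t * `|v|).
  apply: le_trans (sublinear_dist_le _ _ _ _ sp pk) _.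
  rewrite opprD addrACA subrr add0r -scalerBl -mulrBl -natrB// subSnn mul1r.
  by rewrite normrZ gtr0_norm.
have a_ge j : (j <= N)%N -> a 0 + j%:R * t <= a j.
  elim: j => [|j IH] jN; first by rewrite mul0r addr0.
  have zx : `|x + (j.+1%:R * t) *: v - x| < e.
    rewrite addrAC subrr add0r normrZ ger0_norm; last by rewrite mulr_ge0// ltW.
    apply: le_lt_trans dv; rewrite ler_wpM2r//.
    by rewrite /t mulrCA -[leRHS]mulr1 ler_pM2l// ler_pdivrMr// mul1r ler_nat.
  have := IH (ltnW jN); have := step _ _ zx t0.
  have -> : x + (j.+1%:R * t) *: v + t *: v = x + (j.+2%:R * t) *: v.
    by rewrite -addrA -scalerDl [j.+2%:R]mulrSr mulrDl mul1r.
  have -> : x + (j.+1%:R * t) *: v - t *: v = x + (j%:R * t) *: v.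
    by rewrite -addrA -scalerBl mulrSr mulrDl mul1r addrK.
  have jt : j.+1%:R * t = j%:R * t + t by rewrite mulrSr mulrDl mul1r.
  by rewrite [in a 0 + j.+1%:R * t]jt /a => zt aj; lra.
have := a_ge N (leqnn N); have := a_le N; have := a_le 0.
rewrite !ler_norml => /andP[+ _] /andP[_ +].
have : 2 * k * `|v| * t < N%:R * t by rewrite ltr_pM2r.
lra.
Qed.

Lemma dense_bigcap_countable (T : Type) (D : set T) (G : T -> set X) : countable D ->
  (forall i, D i -> open (G i) /\ dense (G i)) -> dense (\bigcap_(i in D) G i).
Proof.
move=> /pfcard_geP[->|[h]] DG.
  by rewrite bigcap_set0 => O O0 _; rewrite setIT.
have dB := @Baire R X (fun n => G (h n)) (fun n => DG _ (funS n I)).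
move=> O O0 oO; have [x [Ox Gx]] := dB O O0 oO; exists x; split=> // i Di.
by have [n _ <-] := (@surj _ _ _ _ h) i Di; exact: Gx.
Qed.

(** By Baire, some [x0] near [x] is smooth along all directions of a countable dense set. The last
    clause is the form of smoothness that later fills the tangent half-space. *)
Theorem mazur p (k : R) x (e : R) : @separable R X -> sublinear p -> 0 < k ->
  (forall z, p z <= k * `|z|) -> 0 < e ->
  exists2 x0, `|x - x0| < e & exists f : X -> R,
  [/\ is_linear_functional f, forall y, f y <= p y, f x0 = p x0 &
   forall y, f y < 0 -> exists2 t : R, 0 < t & p (x0 + t *: y) < p x0].
Proof.
move=> [D [cD dD]] sp k0 pk e0.
have dG : dense (\bigcap_(v in D) smooth_along p v).
  apply: dense_bigcap_countable => // v _.
  by split; [exact: open_smooth_along pk|exact: dense_smooth_along pk].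
have [x0 Gx0 xx0] := dense_near _ _ _ x e dG e0.
exists x0 => //; have [f [lf fp fx0]] := hahn_banach _ x0 sp.
exists f; split=> // y fy.
(* By homogeneity y may be replaced by its multiple on which f is -3; this is why the
   slope bound 1 in [smooth_along], for directions in a dense set, is enough. *)
pose l := - 3 / f y; have l0 : 0 < l by rewrite /l -mulrNN opprK -invrN divr_gt0// oppr_gt0.
have lfy : f (l *: y) = - 3 by rewrite linear_functionalZ// /l divfK// lt_eqF.
have k2 : 0 < k^-1 / 2 by rewrite divr_gt0// invr_gt0.
have [v Dv yv] := dense_near _ _ _ (l *: y) _ dD k2.
have kyv : k * `|l *: y - v| < 2^-1 by rewrite -ltr_pdivlMl.
have [t t0 ht] := Gx0 v Dv; exists (t * l); first exact: mulr_gt0.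
rewrite -scalerA.
(* Together the bounds give a value below [p x0 + t * (1 - 3 + 1/2 + 1/2)]: 1 from the second
   difference, each half from replacing [l *: y] by [v]. *)
have p1 : p (x0 + t *: (l *: y)) <= p (x0 + t *: v) + t * (k * `|l *: y - v|).
  have -> : x0 + t *: (l *: y) = x0 + t *: v + t *: (l *: y - v).
    by rewrite -addrA -scalerDr [v + _]addrC subrK.
  by rewrite (le_trans (sp.1 _ _))// lerD2l (sublinearZ _ _ _ sp (ltW t0)) ler_pM2l.
have p2 : p x0 - t * f v <= p (x0 - t *: v).
  by rewrite -fx0 -linear_functionalZ// -linear_functionalB.
have p3 : f v <= - 3 + k * `|l *: y - v|.
  rewrite -lfy -lerBlDl -linear_functionalB// distrC.
  by apply: le_trans (fp _) (pk _).
have q1 : t * (k * `|l *: y - v|) < t * 2^-1 by rewrite ltr_pM2l.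
have q2 : t * f v <= t * (- 3 + k * `|l *: y - v|) by rewrite ler_pM2l.
lra.
Qed.

End Mazur.

(** * Contractive half-spaces and their countable intersections *)

Section HalfSpaces.
Context {R : realType} {X : normedModType R}.
Implicit Types (f : X -> R) (F : set X) (x y z u v : X).

(** Outside points slide along [u] to the hyperplane [f = d]. For two outside points the difference
    is projected along [u]; for a mixed pair it becomes a convex combination of itself and its
    projection. *)
Lemma half_space_contractive f u (d : R) : in_dual f -> f u = 1 ->
  (forall y, `|y - f y *: u| <= `|y|) -> contractive_half_space [set x | f x <= d].
Proof.
move=> df fu uP; have lf := df.1; split.
  exists f, d; split=> //; split=> // f0.
  by move: fu; rewrite f0 => /esym/eqP; rewrite oner_eq0.
split; first by exists (d *: u); rewrite /= linear_functionalZ// fu mulr1.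
pose P x := if f x <= d then x else x - (f x - d) *: u.
have mixed x y : f x <= d -> d < f y -> `|x - (y - (f y - d) *: u)| <= `|x - y|.
  move=> fx fy; have g0 : 0 < f y - f x by rewrite subr_gt0 (le_lt_trans fx).
  pose s := (f y - d) / (f y - f x).
  have s0 : 0 <= s by apply: divr_ge0; [rewrite subr_ge0 ltW|exact: ltW].
  have s1 : 0 <= 1 - s by rewrite subr_ge0 ler_pdivrMr// mul1r lerD2l lerN2.
  have -> : x - (y - (f y - d) *: u) =
      (1 - s) *: (x - y) + s *: ((x - y) - f (x - y) *: u).
    rewrite (scalerBr s) addrA -scalerDl subrK scale1r scalerA linear_functionalB//.
    rewrite -(opprB (f y)) mulrN /s divfK ?gt_eqF// scaleNr opprK.
    by rewrite opprB addrA addrAC.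
  apply: le_trans (ler_normD _ _) _.
  rewrite (normrZ (1 - s)) (normrZ s) (ger0_norm s0) (ger0_norm s1).
  by have := ler_wpM2l s0 (uP (x - y)); lra.
exists P; split=> [x|]; last split=> [x fx|x y].
- rewrite /P /=; case: ifPn => // _.
  by rewrite linear_functionalB// linear_functionalZ// fu mulr1 subKr.
- by rewrite /P fx.
rewrite /P; have [fx|fx] := leP (f x) d; have [fy|fy] := leP (f y) d => //.
- exact: mixed.
- by rewrite distrC [leRHS]distrC mixed.
have -> : x - (f x - d) *: u - (y - (f y - d) *: u) = (x - y) - f (x - y) *: u.
  rewrite linear_functionalB// (opprD y) addrACA -opprD -scalerBl.
  by congr (_ - _ *: _); lra.
exact: uP.
Qed.

(** The rescaled points [w n] are as close as [v] to any [y] with [e + y / n.+1] in [F]. Their weak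
    limit [l] satisfies [f l <= 0] and is as close as [v] to every point where [f < 0], hence to the
    kernel. *)
Lemma tangent_half_space_direction F f e v : @reflexive_space R X ->
  existence_set F -> in_dual f -> F e -> (forall z, F z -> f z <= f e) -> f v = 1 ->
  (forall y, f y < 0 ->
    exists2 t : R, 0 < t & forall s, 0 < s -> s <= t -> F (e + s *: y)) ->
  exists2 u, f u = 1 & forall y, `|y - f y *: u| <= `|y|.
Proof.
move=> refl [_ exF] df Fe fe fv cone; have lf := df.1.
have /choice[d dP] : forall n : nat, exists d, RF F (e + n.+1%:R^-1 *: v) d.
  by move=> n; exact: exF.
pose w n := n.+1%:R *: (d n - e).
have wP n y : F (e + n.+1%:R^-1 *: y) -> `|w n - y| <= `|v - y|.
  move=> /(dP n).2.
  have n0 : 0 < n.+1%:R :> R by [].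
  rewrite opprD addrACA subrr add0r -scalerBr normrZ gtr0_norm ?invr_gt0//.
  rewrite ler_pdivlMl// -{1}(gtr0_norm n0) -normrZ.
  by rewrite addrA scalerBr scalerA divff ?gt_eqF// scale1r.
have [U [UU ooU]] := @ultraFilterLemma nat \oo _.
have [l wl] : exists l, weak_cvg U w l.
  apply: (@reflexive_weak_cvg _ _ _ _ _ w `|v|) => //.
  apply: nearW => n; rewrite -[w n]subr0 -[v]subr0; apply: wP.
  by rewrite scaler0 addr0.
have fl : f l <= 0.
  apply: (closed_cvg _ (@closed_le _ 0) _ _ (wl f df)).
  apply: nearW => n /=; rewrite linear_functionalZ// linear_functionalB//.
  by rewrite mulr_ge0_le0// subr_le0 fe//; have [] := dP n.
have lv_neg y : f y < 0 -> `|l - y| <= `|v - y|.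
  move=> /cone[t t0 tP]; apply: (weak_cvg_dist_le wl (weak_cvg_cst _ y)).
  apply: ooU; near=> n; apply: wP; apply: tP; first by rewrite invr_gt0.
  rewrite invf_ple ?posrE//; near: n.
  exists (Num.bound t^-1) => // n /= tn.
  rewrite ltW// (lt_le_trans (archi_boundP _)) ?invr_ge0 ?(ltW t0)//.
  by rewrite ler_nat (leq_trans tn).
have lv y : f y = 0 -> `|l - y| <= `|v - y|.
  move=> fy; apply/ler_addgt0Pr => h h0.
  (* The kernel point [y] is approximated by [y - s *: v], where [f] is negative, at a total cost of
     at most [h]. *)
  pose s := h / (2 * (`|v| + 1)).
  have v1 : 0 < 2 * (`|v| + 1) by rewrite mulr_gt0// ltr_wpDl.
  have s0 : 0 < s by rewrite divr_gt0.
  have sv : 2 * `|s *: v| <= h.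
    rewrite normrZ gtr0_norm// /s mulrCA mulrAC ler_pdivrMr// ler_pM2l// ler_pM2l//.
    by rewrite lerDl.
  have : `|l - (y - s *: v)| <= `|v - (y - s *: v)|.
    apply: lv_neg; rewrite linear_functionalB// linear_functionalZ// fy fv mulr1.
    by rewrite sub0r oppr_lt0.
  rewrite !opprB !addrA !(addrAC _ (s *: v)) => lvs.
  have := ler_normD (v - y) (s *: v).
  have := ler_normD (l - y + s *: v) (- (s *: v)).
  rewrite addrK normrN; lra.
pose b := - f l; have b0 : 0 <= b by rewrite oppr_ge0.
have b1 : 0 < 1 + b by rewrite ltr_pwDl.
(* The point [v - u] is where the segment from [l] to [v] meets the kernel of [f]. *)
pose u := (1 + b)^-1 *: (v - l).
have uP y : f y = 0 -> `|v - y - u| <= `|v - y|.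
  move=> /lv ly.
  have -> : v - y - u = (1 + b)^-1 *: (b *: (v - y) + (l - y)).
    apply: (@scalerI _ _ (1 + b)); first exact: lt0r_neq0.
    rewrite scalerBr !scalerA divff ?gt_eqF// !scale1r scalerDl scale1r.
    by rewrite opprB addrC addrA [l - v + _]addrA subrK addrC.
  rewrite normrZ gtr0_norm ?invr_gt0// ler_pdivrMl//.
  by apply: le_trans (ler_normD _ _) _; rewrite normrZ (ger0_norm b0); lra.
have fu : f u = 1 by rewrite linear_functionalZ// linear_functionalB// fv mulVf// gt_eqF.
clearbody u; exists u => // z; have [->|fz] := eqVneq (f z) 0; first by rewrite scale0r subr0.
(* This argument is in the kernel, and its difference from [v] is a multiple of [z]; homogeneity
   does the rest. *)
have := uP (v - (f z)^-1 *: z); rewrite subKr linear_functionalB// fv.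
rewrite linear_functionalZ// mulVf// subrr => /(_ erefl).
have -> : z - f z *: u = f z *: ((f z)^-1 *: z - u).
  by rewrite scalerBr scalerA divff// scale1r.
rewrite -(@ler_pM2l _ `|f z|) ?normr_gt0// -!normrZ.
by rewrite scalerA divff// scale1r.
Unshelve. all: end_near. Qed.

(** One half-space is chosen for each ball with center in [D] and radius [n.+1%:R^-1] that some
    admissible half-space misses; these balls cover the complement of [F]. *)
Lemma countable_bigcap_half_spaces F : @separable R X ->
  (forall x, ~ F x -> exists H, [/\ contractive_half_space H, F `<=` H & ~ H x]) ->
  countable_inter_contractive_half_spaces F.
Proof.
move=> [D [cD dD]] sepF.
pose good (dn : X * nat) (H : set X) := [/\ contractive_half_space H, F `<=` H &
  forall z, `|dn.1 - z| < dn.2.+1%:R^-1 -> ~ H z].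
have /choice[h hP] : forall dn, exists H, (exists H', good dn H') -> good dn H.
  move=> dn; have [[H gH]|nH] := pselect (exists H', good dn H').
    by exists H.
  (* A dummy value: such pairs are left out of the index set. *)
  by exists set0.
exists (h @` [set dn | D dn.1 /\ exists H, good dn H]); split; last split.
- apply: sub_countable (card_image_le _ _) _.
  apply: sub_countable (countableX cD (countableP [set: nat])).
  by apply: subset_card_le => dn [].
- by move=> _ [dn [_ /hP[]]] cH _ _ <-.
- apply/seteqP; split=> [x Fx _ [dn [_ /hP[_ FH _]]] <-|x hx]; first exact: FH.
  apply: contrapT => /sepF[H [cH FH Hx]].
  have [[f [d [df [_ HE]]]] _] := cH.
  have /nbhs_normP[e /= e0 eH] : nbhs x [set z | d < f z].
    apply: open_nbhs_nbhs; split; last first.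
      by rewrite /= ltNge; apply/negP => fx; apply: Hx; rewrite HE.
    by apply: (open_comp _ (@open_gt _ d)) => z _; exact: df.2.
  pose n := Num.bound (2 / e).
  have nV : 0 < n.+1%:R^-1 :> R by rewrite invr_gt0.
  have ne : n.+1%:R^-1 < e / 2.
    rewrite invf_plt ?posrE ?divr_gt0// invf_div.
    by rewrite (lt_trans (archi_boundP _)) ?ltr_nat// divr_ge0// ltW.
  have [v Dv xv] := dense_near _ _ _ x _ dD nV.
  have gH : good (v, n) H.
    split=> // z /= vz; rewrite HE /= leNgt => /negP; apply; apply: eH => /=.
    apply: le_lt_trans (ler_distD v _ _) _.
    by rewrite [e]splitr ltrD// (lt_trans _ ne).
  have [_ _ /(_ x)] := hP (v, n) (ex_intro _ H gH).
  apply; first by rewrite /= distrC.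
  by apply: hx; exists (v, n) => //; split=> //; exists H.
Qed.

End HalfSpaces.

(** * Implications between the four properties *)

Lemma contractive_existence_set (R : realType) (X : normedModType R) (F : set X) :
  contractive F -> existence_set F.
Proof.
move=> [F0 [P [PF [Pid Pn]]]]; split=> // x; exists (P x); split=> // c Fc.
by rewrite -{1}(Pid c Fc).
Qed.

Lemma existence_set_optimal (R : realType) (X : normedModType R) (F : set X) :
  existence_set F -> optimal F.
Proof.
move=> [_ exF]; apply/seteqP; split=> [z zF|z Fz x /(_ z Fz)].
  by have [d [Fd dz]] := exF z; rewrite -(zF d dz).
by rewrite subrr normr0 normr_le0 subr_eq0 => /eqP.
Qed.

Lemma existence_set_separation (R : realType) (X : completeNormedModType R)
  (F : set X) (x : X) :
  @strictly_convex R X -> @reflexive_space R X -> @separable R X ->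
  existence_set F -> F° !=set0 -> ~ F x ->
  exists H, [/\ contractive_half_space H, F `<=` H & ~ H x].
Proof.
move=> sc refl sepX exF [a /nbhs_normP[r /= r0 aF]] xF.
have ballF z : `|z - a| < r -> F z by rewrite distrC => /aF.
have cvF := fun y z s t => @existence_set_convex R X F y z s t sc exF.
have clF := fun y => @existence_set_closed R X F y exF.
pose p := gauge_at F a.
have sp : sublinear p := sublinear_gauge_at F a r r0 ballF cvF.
have pr y : p y <= r^-1 * `|y| := gauge_at_le_norm F a r r0 ballF y.
have rV : 0 < r^-1 by rewrite invr_gt0.
have px : 1 < p (x - a).
  rewrite ltNge; apply/negP => /(gauge_at_le1P F a r r0 ballF cvF clF).
  by rewrite addrC subrK.
(* Passing between [x - a] and [x0] costs less than half of [p (x - a) - 1]; done twice, it still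
   leaves [f (x - a) > 1]. *)
pose h := r * (p (x - a) - 1) / 2.
have h0 : 0 < h by rewrite divr_gt0// mulr_gt0// subr_gt0.
have [x0 xx0 [f [lf fp fx0 fneg]]] := mazur p r^-1 (x - a) h sepX sp rV pr h0.
have df : in_dual f.
  by apply: (@in_dual_le _ _ r^-1) => // y; apply: le_trans (fp y) (pr y).
have rh : r^-1 * `|x - a - x0| < (p (x - a) - 1) / 2.
  by rewrite ltr_pdivrMl// mulrA.
have /ler_normlP[pxx0 _] := sublinear_dist_le p r^-1 x0 (x - a) sp pr.
rewrite distrC in pxx0.
have px0 : 1 < p x0 by lra.
have px00 : 0 < p x0 by lra.
have fxa : 1 < f (x - a).
  have := le_trans (fp (x0 - (x - a))) (pr _); rewrite distrC linear_functionalB// fx0.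
  lra.
(* The radial projection of [a + x0] to gauge 1, where [f] attains its maximum over [F]. *)
pose e := a + (p x0)^-1 *: x0.
have pe : p ((p x0)^-1 *: x0) = 1.
  by rewrite sublinearZ ?invr_ge0 ?ltW// mulVf// gt_eqF.
have Fe : F e by apply: (gauge_at_le1P F a r r0 ballF cvF clF); rewrite -/p pe.
have fe : f e = f a + 1.
  by rewrite linear_functionalD// linear_functionalZ// fx0 mulVf// gt_eqF.
have Ff z : F z -> f z <= f e.
  move=> Fz; have := le_trans (fp (z - a)) (gauge_at_le1 F a z Fz).
  by rewrite linear_functionalB// fe; lra.
have fv : f ((p x0)^-1 *: x0) = 1.
  by rewrite linear_functionalZ// fx0 mulVf// gt_eqF.
have [|u fu uP] := tangent_half_space_direction _ _ e _ refl exF df Fe Ff fv.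
  move=> y /fneg[t t0 ty]; exists (t / p x0); first exact: divr_gt0.
  move=> s s0 st; rewrite -addrA; apply: (gauge_at_lt1 F a r r0 ballF cvF).
  (* With weight [l], the vector [e + s *: y - a] is [(p x0)^-1] times a convex combination of [x0]
     and [x0 + t *: y], so its gauge is below 1. *)
  pose l := s * p x0 / t.
  have l0 : 0 < l by rewrite divr_gt0// mulr_gt0.
  have l1 : l <= 1 by rewrite ler_pdivrMr// mul1r -ler_pdivlMr.
  have -> : (p x0)^-1 *: x0 + s *: y = (p x0)^-1 *: ((1 - l) *: x0 + l *: (x0 + t *: y)).
    rewrite (scalerDr l) addrA -scalerDl subrK scale1r scalerDr !scalerA.
    by rewrite -mulrA /l divfK ?gt_eqF// mulrCA mulVf ?mulr1// gt_eqF.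
  rewrite -/p sublinearZ ?invr_ge0 ?(ltW px00)// ltr_pdivrMl// mulr1.
  apply: le_lt_trans (sp.1 _ _) _.
  rewrite (sublinearZ p (1 - l)) ?subr_ge0// (sublinearZ p l) ?(ltW l0)//.
  have : l * p (x0 + t *: y) < l * p x0 by rewrite ltr_pM2l.
  lra.
exists [set z | f z <= f e]; split=> //.
  exact: half_space_contractive uP.
by move=> /=; move: fxa; rewrite fe linear_functionalB//; lra.
Qed.

Theorem theorem26 (R : realType) (X : completeNormedModType R) (F : set X) :
  @strictly_convex R X -> @reflexive_space R X -> @separable R X ->
  bounded_set F -> F° !=set0 ->
  [/\ existence_set F <-> contractive F,
      existence_set F <-> countable_inter_contractive_half_spaces F &
      existence_set F <-> optimal F].
Proof.
move=> sc refl sepX _ F0.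
have Fn0 : F !=set0 by have [a /interior_subset Fa] := F0; exists a.
have ac : existence_set F -> countable_inter_contractive_half_spaces F.
  move=> exF; apply: countable_bigcap_half_spaces => // x.
  exact: existence_set_separation.
have cb : countable_inter_contractive_half_spaces F -> contractive F.
  move=> [I [_ [cI FI]]]; apply: (@bigcap_contractive _ _ F I) => // H /cI.
  by case.
have ba := @contractive_existence_set R X F.
split; split=> //.
- by move=> /ac/cb.
- by move=> /cb/ba.
- exact: existence_set_optimal.
- exact: optimal_existence_set.
Qed.
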